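(* Let $\mathcal{K}$ be a category, let $F:\mathcal{K}\to\mathcal{K}$ be an endofunctor that has a right adjoint $R$, and let $O$ be an object of $\mathcal{K}$. Let $F\text{-}\mathsf{Mre}$ and $F\text{-}\mathsf{Mly}$ be the categories of $F$-Moore machines and of $F$-Mealy machines of output $O$. (1) Let $\mathcal{J}$ be a category such that $\mathcal{K}$ admits colimits of shape $\mathcal{J}$. Then $F\text{-}\mathsf{Mre}$ and $F\text{-}\mathsf{Mly}$ have colimits of shape $\mathcal{J}$, and they are computed as in $\mathcal{K}$. (2) Equalizers, and more generally all connected limits, are computed in $F\text{-}\mathsf{Mre}$ and in $F\text{-}\mathsf{Mly}$ as they are computed in $\mathcal{K}$. If $\mathcal{K}$ has countable products and pullbacks, then $F\text{-}\mathsf{Mre}$ and $F\text{-}\mathsf{Mly}$ also have products of any finite cardinality (in particular, a terminal object).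
   Context: An $F$-Mealy machine of output $O$ is a triple $(E,d,s)$ with $E$ an object of $\mathcal{K}$ and $d:FE\to E$, $s:FE\to O$ morphisms of $\mathcal{K}$. A morphism $(E,d,s)\to(T,d',s')$ of $F$-Mealy machines is a morphism $f:E\to T$ of $\mathcal{K}$ with $f\circ d=d'\circ Ff$ and $s'\circ Ff=s$. An $F$-Moore machine of output $O$ is a triple $(E,d,s)$ with $E$ an object of $\mathcal{K}$ and $d:FE\to E$, $s:E\to O$ morphisms of $\mathcal{K}$. A morphism $(E,d,s)\to(T,d',s')$ of $F$-Moore machines is a morphism $f:E\to T$ of $\mathcal{K}$ with $f\circ d=d'\circ Ff$ and $s'\circ f=s$. In both cases composition and identities are those of $\mathcal{K}$. Saying that (co)limits of a given shape are ''computed as in $\mathcal{K}$'' means that the forgetful functor to $\mathcal{K}$, $(E,d,s)\mapsto E$, creates them: whenever the image in $\mathcal{K}$ of a diagram of machines has a (co)limit (co)cone in $\mathcal{K}$, this (co)cone lifts uniquely to a (co)cone of machines, and the lifted (co)cone is a (co)limit. A connected limit is a limit indexed by a nonempty connected category. *)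

(* Defs.v *)
From Stdlib Require Import Relations ProofIrrelevance FinFun.

Set Implicit Arguments.
Unset Strict Implicit.

(** * Categories, functors, adjunctions *)

Declare Scope cat_scope.
Delimit Scope cat_scope with cat.
Reserved Notation "g ∘ f" (at level 40, left associativity).

Record Category := {
  ob :> Type;
  hom : ob -> ob -> Type;
  idm : forall a, hom a a;
  comp : forall a b c, hom b c -> hom a b -> hom a c;
  comp_id_l : forall a b (f : hom a b), comp (idm b) f = f;
  comp_id_r : forall a b (f : hom a b), comp f (idm a) = f;
  comp_assoc : forall a b c d (h : hom c d) (g : hom b c) (f : hom a b),
    comp h (comp g f) = comp (comp h g) f
}.
Arguments hom {_} _ _.
Arguments idm {_} _.
Arguments comp {_ _ _ _} _ _.

Notation "g ∘ f" := (comp g f) : cat_scope.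
Open Scope cat_scope.

Record Functor (C D : Category) := {
  fobj :> C -> D;
  fmap : forall a b : C, hom a b -> hom (fobj a) (fobj b);
  fmap_id : forall a : C, fmap (idm a) = idm (fobj a);
  fmap_comp : forall (a b c : C) (g : hom b c) (f : hom a b),
    fmap (g ∘ f) = fmap g ∘ fmap f
}.
Arguments fmap {_ _} _ {_ _} _.

Lemma comp_functor_id (A B C : Category) (G : Functor B C) (F : Functor A B)
    (a : A) : fmap G (fmap F (idm a)) = idm (G (F a)).
Proof. now rewrite !fmap_id. Qed.

Lemma comp_functor_comp (A B C : Category) (G : Functor B C) (F : Functor A B)
    (a b c : A) (g : hom b c) (f : hom a b) :
  fmap G (fmap F (g ∘ f)) = fmap G (fmap F g) ∘ fmap G (fmap F f).
Proof. now rewrite !fmap_comp. Qed.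

Definition comp_functor (A B C : Category) (G : Functor B C) (F : Functor A B) :
  Functor A C := {|
  fobj := fun a => G (F a);
  fmap := fun a b f => fmap G (fmap F f);
  fmap_id := comp_functor_id G F;
  fmap_comp := comp_functor_comp G F
|}.

(* [Adjunction F R] : F is left adjoint to R. *)
Record Adjunction (C D : Category) (F : Functor C D) (R : Functor D C) := {
  transpose : forall (a : C) (b : D), hom (F a) b -> hom a (R b);
  untranspose : forall (a : C) (b : D), hom a (R b) -> hom (F a) b;
  transposeK : forall (a : C) (b : D) (f : hom (F a) b),
    untranspose (transpose f) = f;
  untransposeK : forall (a : C) (b : D) (g : hom a (R b)),
    transpose (untranspose g) = g;
  transpose_natural : forall (a a' : C) (b b' : D)
      (h : hom a' a) (f : hom (F a) b) (k : hom b b'),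
    transpose (k ∘ f ∘ fmap F h) = fmap R k ∘ transpose f ∘ h
}.

(** * Limits and colimits *)

Record Cone (J C : Category) (X : Functor J C) := {
  cone_apex : C;
  cone_leg : forall j : J, hom cone_apex (X j);
  cone_natural : forall (i j : J) (u : hom i j),
    fmap X u ∘ cone_leg i = cone_leg j
}.
Arguments cone_leg {_ _ _} _ _.

Definition is_limit (J C : Category) (X : Functor J C) (k : Cone X) : Prop :=
  forall c : Cone X, exists! u : hom (cone_apex c) (cone_apex k),
    forall j : J, cone_leg k j ∘ u = cone_leg c j.

Record Cocone (J C : Category) (X : Functor J C) := {
  cocone_apex : C;
  cocone_leg : forall j : J, hom (X j) cocone_apex;
  cocone_natural : forall (i j : J) (u : hom i j),
    cocone_leg j ∘ fmap X u = cocone_leg i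
}.
Arguments cocone_leg {_ _ _} _ _.

Definition is_colimit (J C : Category) (X : Functor J C) (k : Cocone X) : Prop :=
  forall c : Cocone X, exists! u : hom (cocone_apex k) (cocone_apex c),
    forall j : J, u ∘ cocone_leg k j = cocone_leg c j.

Definition has_colimits (C J : Category) : Prop :=
  forall X : Functor J C, exists k : Cocone X, is_colimit k.

Lemma map_cone_natural (J C D : Category) (U : Functor C D) (X : Functor J C)
    (c : Cone X) (i j : J) (u : hom i j) :
  fmap (comp_functor U X) u ∘ fmap U (cone_leg c i) = fmap U (cone_leg c j).
Proof. simpl. now rewrite <- fmap_comp, cone_natural. Qed.

Definition map_cone (J C D : Category) (U : Functor C D) (X : Functor J C)
  (c : Cone X) : Cone (comp_functor U X) := {|
  cone_apex := U (cone_apex c);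
  cone_leg := fun j => fmap U (cone_leg c j) : hom _ (comp_functor U X j);
  cone_natural := map_cone_natural U c
|}.

Lemma map_cocone_natural (J C D : Category) (U : Functor C D) (X : Functor J C)
    (c : Cocone X) (i j : J) (u : hom i j) :
  fmap U (cocone_leg c j) ∘ fmap (comp_functor U X) u = fmap U (cocone_leg c i).
Proof. simpl. now rewrite <- fmap_comp, cocone_natural. Qed.

Definition map_cocone (J C D : Category) (U : Functor C D) (X : Functor J C)
  (c : Cocone X) : Cocone (comp_functor U X) := {|
  cocone_apex := U (cocone_apex c);
  cocone_leg := fun j => fmap U (cocone_leg c j) : hom (comp_functor U X j) _;
  cocone_natural := map_cocone_natural U c
|}.

(* Strict creation: a lift is a cone whose image is equal, not merely
   isomorphic, to the given one. *)
Definition creates_limits (C D : Category) (U : Functor C D) (J : Category) : Prop :=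
  forall (X : Functor J C) (k : Cone (comp_functor U X)), is_limit k ->
    (exists! c : Cone X, map_cone U c = k) /\
    (forall c : Cone X, map_cone U c = k -> is_limit c).

Definition creates_colimits (C D : Category) (U : Functor C D) (J : Category) : Prop :=
  forall (X : Functor J C) (k : Cocone (comp_functor U X)), is_colimit k ->
    (exists! c : Cocone X, map_cocone U c = k) /\
    (forall c : Cocone X, map_cocone U c = k -> is_colimit c).

(** * Particular shapes *)

(* Nonempty, and any two objects are joined by a zigzag of morphisms. *)
Definition connected (J : Category) : Prop :=
  inhabited J /\
  forall i j : J,
    clos_refl_sym_trans J (fun a b => inhabited (hom a b)) i j.

(* The category [false ⇉ true], the shape of equalizers: the two arrows
   [false -> true] are the two booleans. *)
Definition pp_hom (a b : bool) : Set :=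
  match a, b with
  | false, true => bool
  | true, false => Empty_set
  | _, _ => unit
  end.

Definition pp_id (a : bool) : pp_hom a a :=
  match a with true => tt | false => tt end.

Definition pp_comp (a b c : bool) : pp_hom b c -> pp_hom a b -> pp_hom a c :=
  match a, b, c with
  | false, false, false => fun _ _ => tt
  | false, false, true => fun g _ => g
  | false, true, true => fun _ f => f
  | false, true, false => fun g _ => match g with end
  | true, true, true => fun _ _ => tt
  | true, true, false => fun g _ => g
  | true, false, _ => fun _ f => match f with end
  end.

Lemma pp_comp_id_l (a b : bool) (f : pp_hom a b) : pp_comp (pp_id b) f = f.
Proof. destruct a, b, f; reflexivity. Qed.

Lemma pp_comp_id_r (a b : bool) (f : pp_hom a b) : pp_comp f (pp_id a) = f.
Proof. destruct a, b, f; reflexivity. Qed.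

Lemma pp_comp_assoc (a b c d : bool) (h : pp_hom c d) (g : pp_hom b c)
    (f : pp_hom a b) : pp_comp h (pp_comp g f) = pp_comp (pp_comp h g) f.
Proof. destruct a, b, c, d; simpl in *; try destruct f; try destruct g;
  try destruct h; reflexivity. Qed.

Definition parallel_pair : Category := {|
  ob := bool;
  hom := pp_hom;
  idm := pp_id;
  comp := pp_comp;
  comp_id_l := pp_comp_id_l;
  comp_id_r := pp_comp_id_r;
  comp_assoc := pp_comp_assoc
|}.

Definition has_products (C : Category) (I : Type) : Prop :=
  forall X : I -> C, exists (p : C) (pi : forall i, hom p (X i)),
    forall (q : C) (f : forall i, hom q (X i)),
      exists! u : hom q p, forall i, pi i ∘ u = f i.

(* Finite or countably infinite. *)
Definition countable (I : Type) : Prop := exists f : I -> nat, Injective f.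

Definition has_countable_products (C : Category) : Prop :=
  forall I : Type, countable I -> has_products C I.

Definition has_finite_products (C : Category) : Prop :=
  forall I : Type, Finite I -> has_products C I.

Definition has_terminal (C : Category) : Prop :=
  exists t : C, forall x : C, exists! u : hom x t, True.

Definition has_pullbacks (C : Category) : Prop :=
  forall (a b c : C) (f : hom a c) (g : hom b c),
    exists (p : C) (p1 : hom p a) (p2 : hom p b),
      f ∘ p1 = g ∘ p2 /\
      forall (q : C) (q1 : hom q a) (q2 : hom q b), f ∘ q1 = g ∘ q2 ->
        exists! u : hom q p, p1 ∘ u = q1 /\ p2 ∘ u = q2.

(** * Moore machines *)

Section Moore.
Variables (K : Category) (F : Functor K K) (O : K).

Record moore := {
  moore_carrier : K;
  moore_d : hom (F moore_carrier) moore_carrier;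
  moore_s : hom moore_carrier O
}.

Record moore_hom (M N : moore) := {
  moore_mor : hom (moore_carrier M) (moore_carrier N);
  moore_mor_d : moore_mor ∘ moore_d M = moore_d N ∘ fmap F moore_mor;
  moore_mor_s : moore_s N ∘ moore_mor = moore_s M
}.

Lemma moore_hom_ext (M N : moore) (f g : moore_hom M N) :
  moore_mor f = moore_mor g -> f = g.
Proof.
destruct f as [f fd fs], g as [g gd gs]; simpl; intros e; subst g.
now f_equal; apply proof_irrelevance.
Qed.

Lemma moore_id_d (M : moore) :
  idm _ ∘ moore_d M = moore_d M ∘ fmap F (idm (moore_carrier M)).
Proof. now rewrite fmap_id, comp_id_l, comp_id_r. Qed.

Definition moore_id (M : moore) : moore_hom M M := {|
  moore_mor := idm (moore_carrier M);
  moore_mor_d := moore_id_d M;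
  moore_mor_s := comp_id_r (moore_s M)
|}.

Lemma moore_comp_d (L M N : moore) (g : moore_hom M N) (f : moore_hom L M) :
  (moore_mor g ∘ moore_mor f) ∘ moore_d L =
  moore_d N ∘ fmap F (moore_mor g ∘ moore_mor f).
Proof.
now rewrite <- comp_assoc, moore_mor_d, comp_assoc, moore_mor_d, fmap_comp, comp_assoc.
Qed.

Lemma moore_comp_s (L M N : moore) (g : moore_hom M N) (f : moore_hom L M) :
  moore_s N ∘ (moore_mor g ∘ moore_mor f) = moore_s L.
Proof. now rewrite comp_assoc, !moore_mor_s. Qed.

Definition moore_comp (L M N : moore) (g : moore_hom M N) (f : moore_hom L M) :
  moore_hom L N := {|
  moore_mor := moore_mor g ∘ moore_mor f;
  moore_mor_d := moore_comp_d g f;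
  moore_mor_s := moore_comp_s g f
|}.

Lemma moore_comp_id_l (M N : moore) (f : moore_hom M N) :
  moore_comp (moore_id N) f = f.
Proof. apply moore_hom_ext, comp_id_l. Qed.

Lemma moore_comp_id_r (M N : moore) (f : moore_hom M N) :
  moore_comp f (moore_id M) = f.
Proof. apply moore_hom_ext, comp_id_r. Qed.

Lemma moore_comp_assoc (L M N P : moore) (h : moore_hom N P)
    (g : moore_hom M N) (f : moore_hom L M) :
  moore_comp h (moore_comp g f) = moore_comp (moore_comp h g) f.
Proof. apply moore_hom_ext, comp_assoc. Qed.

Definition Mre : Category := {|
  ob := moore;
  hom := moore_hom;
  idm := moore_id;
  comp := moore_comp;
  comp_id_l := moore_comp_id_l;
  comp_id_r := moore_comp_id_r;
  comp_assoc := moore_comp_assoc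
|}.

Definition Mre_forget : Functor Mre K := {|
  fobj := moore_carrier : Mre -> K;
  fmap := moore_mor;
  fmap_id := fun _ => eq_refl;
  fmap_comp := fun _ _ _ _ _ => eq_refl
|}.

End Moore.

(** * Mealy machines *)

Section Mealy.
Variables (K : Category) (F : Functor K K) (O : K).

Record mealy := {
  mealy_carrier : K;
  mealy_d : hom (F mealy_carrier) mealy_carrier;
  mealy_s : hom (F mealy_carrier) O
}.

Record mealy_hom (M N : mealy) := {
  mealy_mor : hom (mealy_carrier M) (mealy_carrier N);
  mealy_mor_d : mealy_mor ∘ mealy_d M = mealy_d N ∘ fmap F mealy_mor;
  mealy_mor_s : mealy_s N ∘ fmap F mealy_mor = mealy_s M
}.

Lemma mealy_hom_ext (M N : mealy) (f g : mealy_hom M N) :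
  mealy_mor f = mealy_mor g -> f = g.
Proof.
destruct f as [f fd fs], g as [g gd gs]; simpl; intros e; subst g.
now f_equal; apply proof_irrelevance.
Qed.

Lemma mealy_id_d (M : mealy) :
  idm _ ∘ mealy_d M = mealy_d M ∘ fmap F (idm (mealy_carrier M)).
Proof. now rewrite fmap_id, comp_id_l, comp_id_r. Qed.

Lemma mealy_id_s (M : mealy) :
  mealy_s M ∘ fmap F (idm (mealy_carrier M)) = mealy_s M.
Proof. now rewrite fmap_id, comp_id_r. Qed.

Definition mealy_id (M : mealy) : mealy_hom M M := {|
  mealy_mor := idm (mealy_carrier M);
  mealy_mor_d := mealy_id_d M;
  mealy_mor_s := mealy_id_s M
|}.

Lemma mealy_comp_d (L M N : mealy) (g : mealy_hom M N) (f : mealy_hom L M) :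
  (mealy_mor g ∘ mealy_mor f) ∘ mealy_d L =
  mealy_d N ∘ fmap F (mealy_mor g ∘ mealy_mor f).
Proof.
now rewrite <- comp_assoc, mealy_mor_d, comp_assoc, mealy_mor_d, fmap_comp, comp_assoc.
Qed.

Lemma mealy_comp_s (L M N : mealy) (g : mealy_hom M N) (f : mealy_hom L M) :
  mealy_s N ∘ fmap F (mealy_mor g ∘ mealy_mor f) = mealy_s L.
Proof. now rewrite fmap_comp, comp_assoc, !mealy_mor_s. Qed.

Definition mealy_comp (L M N : mealy) (g : mealy_hom M N) (f : mealy_hom L M) :
  mealy_hom L N := {|
  mealy_mor := mealy_mor g ∘ mealy_mor f;
  mealy_mor_d := mealy_comp_d g f;
  mealy_mor_s := mealy_comp_s g f
|}.

Lemma mealy_comp_id_l (M N : mealy) (f : mealy_hom M N) :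
  mealy_comp (mealy_id N) f = f.
Proof. apply mealy_hom_ext, comp_id_l. Qed.

Lemma mealy_comp_id_r (M N : mealy) (f : mealy_hom M N) :
  mealy_comp f (mealy_id M) = f.
Proof. apply mealy_hom_ext, comp_id_r. Qed.

Lemma mealy_comp_assoc (L M N P : mealy) (h : mealy_hom N P)
    (g : mealy_hom M N) (f : mealy_hom L M) :
  mealy_comp h (mealy_comp g f) = mealy_comp (mealy_comp h g) f.
Proof. apply mealy_hom_ext, comp_assoc. Qed.

Definition Mly : Category := {|
  ob := mealy;
  hom := mealy_hom;
  idm := mealy_id;
  comp := mealy_comp;
  comp_id_l := mealy_comp_id_l;
  comp_id_r := mealy_comp_id_r;
  comp_assoc := mealy_comp_assoc
|}.

Definition Mly_forget : Functor Mly K := {|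
  fobj := mealy_carrier : Mly -> K;
  fmap := mealy_mor;
  fmap_id := fun _ => eq_refl;
  fmap_comp := fun _ _ _ _ _ => eq_refl
|}.

End Mealy.

(* Main.v *)
From Stdlib Require Import Relations List FinFun ProofIrrelevance.
From Stdlib Require Import FunctionalExtensionality IndefiniteDescription.
Require Import Defs.

Set Implicit Arguments.
Unset Strict Implicit.

(** A left adjoint preserves colimits, so a colimit of carriers receives a unique
    compatible [d] and [s]; for limits, [d] is induced by the limit property, and [s]
    is read off at any index, connectedness making the choice irrelevant.  A Mealy
    machine of output [O] is a Moore machine of output [R O].  The terminal Moore
    machine is the product of the [R^n O], and a product of Moore machines is their
    wide pullback over the terminal one. *)

(** * Creation of limits and colimits *)

(** The identity transported along [e]; it allows composition of morphisms whose ends are only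
    propositionally equal. *)
Definition eqhom (C : Category) (a b : C) (e : a = b) : hom a b :=
  eq_rect a (hom a) (idm a) b e.

Definition faithful (C D : Category) (U : Functor C D) : Prop :=
  forall (x y : C) (f g : hom x y), fmap U f = fmap U g -> f = g.

(* Strict creation compares objects by equality, so uniqueness of lifts needs
   morphisms above identities to be identities. *)
Definition reflects_identities (C D : Category) (U : Functor C D) : Prop :=
  forall (x y : C) (f : hom x y) (e : U x = U y),
    fmap U f = eqhom e -> exists e' : x = y, f = eqhom e'.

(** Legs at different apexes live in different types, so they are compared through [eqhom e]; the
    naturality proofs agree by proof irrelevance. *)
Lemma cone_ext (J C : Category) (X : Functor J C) (k c : Cone X)
    (e : cone_apex k = cone_apex c) :
  (forall j, cone_leg c j ∘ eqhom e = cone_leg k j) -> k = c.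
Proof.
destruct k as [a l n], c as [a' l' n']; simpl in *; destruct e; simpl; intros H.
assert (E : l' = l).
{ apply functional_extensionality_dep; intros j; rewrite <- (H j).
  now rewrite comp_id_r. }
subst l'; f_equal; apply proof_irrelevance.
Qed.

Lemma cocone_ext (J C : Category) (X : Functor J C) (k c : Cocone X)
    (e : cocone_apex k = cocone_apex c) :
  (forall j, eqhom e ∘ cocone_leg k j = cocone_leg c j) -> k = c.
Proof.
destruct k as [a l n], c as [a' l' n']; simpl in *; destruct e; simpl; intros H.
assert (E : l = l').
{ apply functional_extensionality_dep; intros j; rewrite <- (H j).
  now rewrite comp_id_l. }
subst l'; f_equal; apply proof_irrelevance.
Qed.

Lemma cone_leg_eqhom (J C : Category) (X : Functor J C) (k c : Cone X)
    (e : k = c) (j : J) :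
  cone_leg c j ∘ eqhom (f_equal (@cone_apex _ _ X) e) = cone_leg k j.
Proof. destruct e; apply comp_id_r. Qed.

Lemma cocone_leg_eqhom (J C : Category) (X : Functor J C) (k c : Cocone X)
    (e : k = c) (j : J) :
  eqhom (f_equal (@cocone_apex _ _ X) e) ∘ cocone_leg k j = cocone_leg c j.
Proof. destruct e; apply comp_id_l. Qed.

(** Both [u] and [v] mediate the cone with legs [cone_leg k j ∘ v]. *)
Lemma limit_hom_ext (J C : Category) (X : Functor J C) (k : Cone X) :
  is_limit k -> forall (q : C) (u v : hom q (cone_apex k)),
  (forall j, cone_leg k j ∘ u = cone_leg k j ∘ v) -> u = v.
Proof.
intros L q u v H.
assert (N : forall i j (w : hom i j),
  fmap X w ∘ (cone_leg k i ∘ v) = cone_leg k j ∘ v).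
{ intros; now rewrite comp_assoc, cone_natural. }
destruct (L (Build_Cone N)) as [w [_ W]].
now rewrite <- (W u H); apply W.
Qed.

Lemma colimit_hom_ext (J C : Category) (X : Functor J C) (k : Cocone X) :
  is_colimit k -> forall (q : C) (u v : hom (cocone_apex k) q),
  (forall j, u ∘ cocone_leg k j = v ∘ cocone_leg k j) -> u = v.
Proof.
intros L q u v H.
assert (N : forall i j (w : hom i j),
  (v ∘ cocone_leg k j) ∘ fmap X w = v ∘ cocone_leg k i).
{ intros; now rewrite <- comp_assoc, cocone_natural. }
destruct (L (Build_Cocone N)) as [w [_ W]].
now rewrite <- (W u H); apply W.
Qed.

(** The last hypothesis lifts the mediating morphism from [D], faithfulness carries its equations
    and uniqueness over to [C], and reflection of identities makes two lifts of one cone equal. *)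
Lemma creates_limits_intro (C D : Category) (U : Functor C D) (J : Category) :
  faithful U -> reflects_identities U ->
  (forall (X : Functor J C) (k : Cone (comp_functor U X)), is_limit k ->
     exists c : Cone X, map_cone U c = k) ->
  (forall (X : Functor J C) (c : Cone X), is_limit (map_cone U c) ->
     forall (y : C) (h : hom (U y) (U (cone_apex c))),
     (forall j, exists g : hom y (X j), fmap U g = fmap U (cone_leg c j) ∘ h) ->
     exists g : hom y (cone_apex c), fmap U g = h) ->
  creates_limits U J.
Proof.
intros faith refl lift initial X k kL.
assert (lim : forall c : Cone X, map_cone U c = k -> is_limit c).
{ intros c <- c'.
  destruct (kL (map_cone U c')) as [h [H _]]; simpl in h, H.
  destruct (initial X c kL _ h) as [g Hg].
  { intros j; exists (cone_leg c' j); now rewrite H. }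
  exists g; split.
  - intros j; apply faith; now rewrite fmap_comp, Hg.
  - intros v V; apply faith, (limit_hom_ext kL); intros j; simpl.
    now rewrite Hg, H, <- (V j), fmap_comp. }
split; [|exact lim].
destruct (lift X k kL) as [c Hc]; exists c; split; [exact Hc|].
intros c' Hc'; pose proof (lim c' Hc' c) as [u [Hu _]].
assert (e : map_cone U c = map_cone U c') by now rewrite Hc.
(* After each leg, the image of the comparison [u] agrees with the transported identity, so [u] lies
   over an identity. *)
destruct (@refl _ _ u (f_equal (@cone_apex _ _ _) e)) as [e' He'].
{ rewrite <- Hc' in kL; apply (limit_hom_ext kL); intros j.
  refine (eq_trans _ (eq_sym (cone_leg_eqhom e j))); simpl.
  now rewrite <- (Hu j), fmap_comp. }
apply cone_ext with e'; intros j; now rewrite <- He'.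
Qed.

Lemma creates_colimits_intro (C D : Category) (U : Functor C D) (J : Category) :
  faithful U -> reflects_identities U ->
  (forall (X : Functor J C) (k : Cocone (comp_functor U X)), is_colimit k ->
     exists c : Cocone X, map_cocone U c = k) ->
  (forall (X : Functor J C) (c : Cocone X), is_colimit (map_cocone U c) ->
     forall (y : C) (h : hom (U (cocone_apex c)) (U y)),
     (forall j, exists g : hom (X j) y, fmap U g = h ∘ fmap U (cocone_leg c j)) ->
     exists g : hom (cocone_apex c) y, fmap U g = h) ->
  creates_colimits U J.
Proof.
intros faith refl lift final X k kL.
assert (lim : forall c : Cocone X, map_cocone U c = k -> is_colimit c).
{ intros c <- c'.
  destruct (kL (map_cocone U c')) as [h [H _]]; simpl in h, H.
  destruct (final X c kL _ h) as [g Hg].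
  { intros j; exists (cocone_leg c' j); now rewrite H. }
  exists g; split.
  - intros j; apply faith; now rewrite fmap_comp, Hg.
  - intros v V; apply faith, (colimit_hom_ext kL); intros j; simpl.
    now rewrite Hg, H, <- (V j), fmap_comp. }
split; [|exact lim].
destruct (lift X k kL) as [c Hc]; exists c; split; [exact Hc|].
intros c' Hc'; pose proof (lim c Hc c') as [u [Hu _]].
assert (e : map_cocone U c = map_cocone U c') by now rewrite Hc.
destruct (@refl _ _ u (f_equal (@cocone_apex _ _ _) e)) as [e' He'].
{ rewrite <- Hc in kL; apply (colimit_hom_ext kL); intros j.
  refine (eq_trans _ (eq_sym (cocone_leg_eqhom e j))); simpl.
  now rewrite <- (Hu j), fmap_comp. }
apply cocone_ext with e'; intros j; now rewrite <- He'.
Qed.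

Lemma has_colimits_of_creates (C D : Category) (U : Functor C D) (J : Category) :
  has_colimits D J -> creates_colimits U J -> has_colimits C J.
Proof.
intros H cr X; destruct (H (comp_functor U X)) as [k kL].
destruct (cr X k kL) as [[c [Hc _]] lim]; exists c; now apply lim.
Qed.

(** Agreement along arrows extends to zigzags, and nonemptiness supplies the value; this yields the
    output on the apex of a connected limit. *)
Lemma connected_constant (J : Category) (A : Type) (s : J -> A) : connected J ->
  (forall i j : J, hom i j -> s i = s j) -> exists a, forall j, s j = a.
Proof.
intros [[i0] zz] H; exists (s i0); intros j.
specialize (zz j i0); induction zz as [a b [u]| | |]; try congruence; eauto.
Qed.

Lemma parallel_pair_connected : connected parallel_pair.
Proof.
assert (E : clos_refl_sym_trans parallel_pair (fun a b => inhabited (hom a b))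
  false true) by (apply rst_step; exact (inhabits true)).
split; [exact (inhabits false)|].
intros [|] [|]; auto using rst_refl, rst_sym.
Qed.

(** * Adjunctions *)

Lemma transpose_comp_r (C D : Category) (F : Functor C D) (R : Functor D C)
    (adj : Adjunction F R) (a a' : C) (b : D) (f : hom (F a) b) (h : hom a' a) :
  transpose adj (f ∘ fmap F h) = transpose adj f ∘ h.
Proof.
pose proof (transpose_natural adj h f (idm b)) as E.
now rewrite comp_id_l, fmap_id, comp_id_l in E.
Qed.

Lemma untranspose_comp_r (C D : Category) (F : Functor C D) (R : Functor D C)
    (adj : Adjunction F R) (a a' : C) (b : D) (g : hom a (R b)) (h : hom a' a) :
  untranspose adj (g ∘ h) = untranspose adj g ∘ fmap F h.
Proof.
rewrite <- (untransposeK adj g) at 1.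
now rewrite <- transpose_comp_r, transposeK.
Qed.

(** Transposition turns cocones under [F X] with apex [b] into cocones under [X] with apex [R b],
    and mediating morphisms correspond. *)
Lemma left_adjoint_colimit (C D : Category) (F : Functor C D) (R : Functor D C)
    (adj : Adjunction F R) (J : Category) (X : Functor J C) (k : Cocone X) :
  is_colimit k -> is_colimit (map_cocone F k).
Proof.
intros kL c.
assert (N : forall i j (w : hom i j),
  transpose adj (cocone_leg c j) ∘ fmap X w = transpose adj (cocone_leg c i)).
{ intros i j w; rewrite <- transpose_comp_r; f_equal.
  exact (cocone_natural c w). }
destruct (kL (Build_Cocone N)) as [u [Hu uniq]]; simpl in u, Hu, uniq.
exists (untranspose adj u); split.
- intros j; simpl; now rewrite <- untranspose_comp_r, Hu, transposeK.
- intros v V; rewrite <- (transposeK adj v); f_equal; apply uniq; intros j.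
  now rewrite <- transpose_comp_r; f_equal; apply V.
Qed.

(** * Creation for machines *)

(** The composites [d j ∘ fmap F (cone_leg k j)] form a cone over [X] with apex
    [F (cone_apex k)]. *)
Lemma algebra_on_limit (K : Category) (F : Functor K K) (J : Category)
    (X : Functor J K) (k : Cone X) (d : forall j, hom (F (X j)) (X j)) :
  (forall i j (w : hom i j), fmap X w ∘ d i = d j ∘ fmap F (fmap X w)) ->
  is_limit k ->
  exists e : hom (F (cone_apex k)) (cone_apex k),
    forall j, cone_leg k j ∘ e = d j ∘ fmap F (cone_leg k j).
Proof.
intros H kL.
assert (N : forall i j (w : hom i j),
  fmap X w ∘ (d i ∘ fmap F (cone_leg k i)) = d j ∘ fmap F (cone_leg k j)).
{ intros i j w; rewrite comp_assoc, H, <- comp_assoc, <- fmap_comp.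
  now rewrite cone_natural. }
destruct (kL (Build_Cone N)) as [e [He _]]; now exists e.
Qed.

(** The structure map starts at [F (cocone_apex k)], so it is induced by the colimit property of the
    image of [k] under [F]. *)
Lemma algebra_on_colimit (K : Category) (F : Functor K K) (J : Category)
    (X : Functor J K) (k : Cocone X) (d : forall j, hom (F (X j)) (X j)) :
  (forall i j (w : hom i j), fmap X w ∘ d i = d j ∘ fmap F (fmap X w)) ->
  is_colimit (map_cocone F k) ->
  exists e : hom (F (cocone_apex k)) (cocone_apex k),
    forall j, cocone_leg k j ∘ d j = e ∘ fmap F (cocone_leg k j).
Proof.
intros H kL.
assert (N : forall i j (w : hom i j),
  (cocone_leg k j ∘ d j) ∘ fmap (comp_functor F X) w = cocone_leg k i ∘ d i).
{ intros i j w; simpl; rewrite <- comp_assoc, <- H, comp_assoc.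
  now rewrite cocone_natural. }
destruct (kL (Build_Cocone N)) as [e [He _]]; exists e; intros j.
symmetry; apply He.
Qed.

Section Machines.
Variables (K : Category) (F : Functor K K) (O : K).

Lemma Mre_forget_faithful : faithful (Mre_forget F O).
Proof. intros x y f g; apply moore_hom_ext. Qed.

Lemma Mly_forget_faithful : faithful (Mly_forget F O).
Proof. intros x y f g; apply mealy_hom_ext. Qed.

(** Over an identity, the two morphism equations become equality of transitions and of outputs. *)
Lemma Mre_forget_reflects_identities : reflects_identities (Mre_forget F O).
Proof.
intros [E d s] [E' d' s'] f e; simpl in *; destruct e; simpl; intros H.
pose proof (moore_mor_d f) as Hd; pose proof (moore_mor_s f) as Hs; simpl in *.
rewrite H in Hd, Hs; rewrite fmap_id, comp_id_l, comp_id_r in Hd.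
rewrite comp_id_r in Hs; subst d s.
exists eq_refl; now apply moore_hom_ext.
Qed.

Lemma Mly_forget_reflects_identities : reflects_identities (Mly_forget F O).
Proof.
intros [E d s] [E' d' s'] f e; simpl in *; destruct e; simpl; intros H.
pose proof (mealy_mor_d f) as Hd; pose proof (mealy_mor_s f) as Hs; simpl in *.
rewrite H in Hd, Hs; rewrite fmap_id, comp_id_l, comp_id_r in Hd.
rewrite fmap_id, comp_id_r in Hs; subst d s.
exists eq_refl; now apply mealy_hom_ext.
Qed.

Lemma Mre_creates_connected_limits (J : Category) :
  connected J -> creates_limits (Mre_forget F O) J.
Proof.
intros cJ; apply creates_limits_intro;
  [apply Mre_forget_faithful|apply Mre_forget_reflects_identities| |].
- intros X k kL.
  destruct (algebra_on_limit (X := comp_functor (Mre_forget F O) X)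
    (d := fun j => moore_d (X j))
    (fun i j w => moore_mor_d (fmap X w)) kL) as [d Hd].
  destruct (connected_constant (s := fun j => moore_s (X j) ∘ cone_leg k j) cJ)
    as [s Hs].
  { intros i j w; rewrite <- (cone_natural k w), comp_assoc; simpl.
    now rewrite moore_mor_s. }
  pose (M := Build_moore d s).
  pose (l := fun j => Build_moore_hom (M := M) (N := X j) (Hd j) (Hs j)).
  assert (N : forall i j (w : hom i j), fmap X w ∘ (l i : hom (M : Mre F O) _) = l j).
  { intros i j w; apply moore_hom_ext; exact (cone_natural k w). }
  exists (Build_Cone N).
  (* The carrier of the lifted apex is [cone_apex k] by definition, hence [eq_refl]. *)
  apply (@cone_ext _ _ _ (map_cone (Mre_forget F O) (Build_Cone N)) k eq_refl).
  intros j; apply comp_id_r.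
- intros X c cL y h H.
  assert (Hd : h ∘ moore_d y = moore_d (cone_apex c) ∘ fmap F h).
  { apply (limit_hom_ext cL); intros j; destruct (H j) as [g Hg]; simpl in *.
    now rewrite !comp_assoc, <- Hg, !moore_mor_d, <- comp_assoc, <- fmap_comp, Hg. }
  assert (Hs : moore_s (cone_apex c) ∘ h = moore_s y).
  (* A single index gives the output equation, and [J] is nonempty. *)
  { destruct cJ as [[j] _]; destruct (H j) as [g Hg]; simpl in *.
    now rewrite <- (moore_mor_s (cone_leg c j)), <- comp_assoc, <- Hg, moore_mor_s. }
  now exists (Build_moore_hom Hd Hs).
Qed.

Lemma Mly_creates_connected_limits (J : Category) :
  connected J -> creates_limits (Mly_forget F O) J.
Proof.
intros cJ; apply creates_limits_intro;
  [apply Mly_forget_faithful|apply Mly_forget_reflects_identities| |].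
- intros X k kL.
  destruct (algebra_on_limit (X := comp_functor (Mly_forget F O) X)
    (d := fun j => mealy_d (X j))
    (fun i j w => mealy_mor_d (fmap X w)) kL) as [d Hd].
  (* Mealy outputs start at [F (X j)], so the legs enter through [F]. *)
  destruct (connected_constant
    (s := fun j => mealy_s (X j) ∘ fmap F (cone_leg k j)) cJ) as [s Hs].
  { intros i j w; rewrite <- (cone_natural k w), fmap_comp, comp_assoc; simpl.
    now rewrite mealy_mor_s. }
  pose (M := Build_mealy d s).
  pose (l := fun j => Build_mealy_hom (M := M) (N := X j) (Hd j) (Hs j)).
  assert (N : forall i j (w : hom i j), fmap X w ∘ (l i : hom (M : Mly F O) _) = l j).
  { intros i j w; apply mealy_hom_ext; exact (cone_natural k w). }
  exists (Build_Cone N).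
  apply (@cone_ext _ _ _ (map_cone (Mly_forget F O) (Build_Cone N)) k eq_refl).
  intros j; apply comp_id_r.
- intros X c cL y h H.
  assert (Hd : h ∘ mealy_d y = mealy_d (cone_apex c) ∘ fmap F h).
  { apply (limit_hom_ext cL); intros j; destruct (H j) as [g Hg]; simpl in *.
    now rewrite !comp_assoc, <- Hg, !mealy_mor_d, <- comp_assoc, <- fmap_comp, Hg. }
  assert (Hs : mealy_s (cone_apex c) ∘ fmap F h = mealy_s y).
  { destruct cJ as [[j] _]; destruct (H j) as [g Hg]; simpl in *.
    now rewrite <- (mealy_mor_s (cone_leg c j)), <- comp_assoc, <- fmap_comp, <- Hg,
      mealy_mor_s. }
  now exists (Build_mealy_hom Hd Hs).
Qed.

(** * Colimits of machines, by means of the right adjoint *)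

Variables (R : Functor K K) (adj : Adjunction F R).

Lemma Mre_creates_colimits (J : Category) : creates_colimits (Mre_forget F O) J.
Proof.
apply creates_colimits_intro;
  [apply Mre_forget_faithful|apply Mre_forget_reflects_identities| |].
- intros X k kL.
  destruct (algebra_on_colimit (X := comp_functor (Mre_forget F O) X)
    (d := fun j => moore_d (X j))
    (fun i j w => moore_mor_d (fmap X w)) (left_adjoint_colimit adj kL)) as [d Hd].
  (* The outputs themselves form a cocone with apex [O]. *)
  destruct (kL (Build_Cocone (X := comp_functor (Mre_forget F O) X)
    (cocone_leg := fun j => moore_s (X j))
    (fun i j w => moore_mor_s (fmap X w)))) as [s [Hs _]]; simpl in s, Hs.
  pose (M := Build_moore d s).
  pose (l := fun j => Build_moore_hom (M := X j) (N := M) (Hd j) (Hs j)).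
  assert (N : forall i j (w : hom i j),
    (l j : hom _ (M : Mre F O)) ∘ fmap X w = l i).
  { intros i j w; apply moore_hom_ext; exact (cocone_natural k w). }
  exists (Build_Cocone N).
  apply (@cocone_ext _ _ _ (map_cocone (Mre_forget F O) (Build_Cocone N)) k eq_refl).
  intros j; apply comp_id_l.
- intros X c cL y h H.
  assert (Hd : h ∘ moore_d (cocone_apex c) = moore_d y ∘ fmap F h).
  (* Both sides start at [F] of the apex, where the images of the legs under [F] are jointly
     epic. *)
  { apply (colimit_hom_ext (left_adjoint_colimit adj cL)); intros j.
    destruct (H j) as [g Hg]; simpl in *.
    now rewrite <- !comp_assoc, <- fmap_comp, <- moore_mor_d, comp_assoc, <- Hg,
      moore_mor_d. }
  assert (Hs : moore_s y ∘ h = moore_s (cocone_apex c)).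
  { apply (colimit_hom_ext cL); intros j; destruct (H j) as [g Hg]; simpl in *.
    now rewrite <- comp_assoc, <- Hg, !moore_mor_s. }
  now exists (Build_moore_hom Hd Hs).
Qed.

Lemma Mly_creates_colimits (J : Category) : creates_colimits (Mly_forget F O) J.
Proof.
apply creates_colimits_intro;
  [apply Mly_forget_faithful|apply Mly_forget_reflects_identities| |].
- intros X k kL; pose proof (left_adjoint_colimit adj kL) as FkL.
  destruct (algebra_on_colimit (X := comp_functor (Mly_forget F O) X)
    (d := fun j => mealy_d (X j))
    (fun i j w => mealy_mor_d (fmap X w)) FkL) as [d Hd].
  (* Mealy outputs form a cocone under [F X], so [s] too is induced by the image of [k] under
     [F]. *)
  destruct (FkL (Build_Cocone
    (X := comp_functor F (comp_functor (Mly_forget F O) X))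
    (cocone_leg := fun j => mealy_s (X j))
    (fun i j w => mealy_mor_s (fmap X w)))) as [s [Hs _]]; simpl in s, Hs.
  pose (M := Build_mealy d s).
  pose (l := fun j => Build_mealy_hom (M := X j) (N := M) (Hd j) (Hs j)).
  assert (N : forall i j (w : hom i j),
    (l j : hom _ (M : Mly F O)) ∘ fmap X w = l i).
  { intros i j w; apply mealy_hom_ext; exact (cocone_natural k w). }
  exists (Build_Cocone N).
  apply (@cocone_ext _ _ _ (map_cocone (Mly_forget F O) (Build_Cocone N)) k eq_refl).
  intros j; apply comp_id_l.
- intros X c cL y h H; pose proof (left_adjoint_colimit adj cL) as FcL.
  assert (Hd : h ∘ mealy_d (cocone_apex c) = mealy_d y ∘ fmap F h).
  { apply (colimit_hom_ext FcL); intros j; destruct (H j) as [g Hg]; simpl in *.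
    now rewrite <- !comp_assoc, <- fmap_comp, <- mealy_mor_d, comp_assoc, <- Hg,
      mealy_mor_d. }
  assert (Hs : mealy_s y ∘ fmap F h = mealy_s (cocone_apex c)).
  { apply (colimit_hom_ext FcL); intros j; destruct (H j) as [g Hg]; simpl in *.
    now rewrite <- comp_assoc, <- fmap_comp, <- Hg, !mealy_mor_s. }
  now exists (Build_mealy_hom Hd Hs).
Qed.

End Machines.

(** * Products of machines *)

Lemma product_hom_ext (C : Category) (I : Type) (X : I -> C) (p : C)
    (pi : forall i, hom p (X i)) :
  (forall (q : C) (f : forall i, hom q (X i)),
     exists! u : hom q p, forall i, pi i ∘ u = f i) ->
  forall (q : C) (u v : hom q p), (forall i, pi i ∘ u = pi i ∘ v) -> u = v.
Proof.
intros P q u v H; destruct (P q (fun i => pi i ∘ v)) as [w [_ W]].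
now rewrite <- (W u H); apply W.
Qed.

(* The wide pullback of [f] is the pullback of [Π f] along the diagonal of [t]. *)
Lemma wide_pullback (C : Category) (I : Type) :
  has_products C I -> has_pullbacks C ->
  forall (X : I -> C) (t : C) (f : forall i, hom (X i) t),
  exists (p : C) (pi : forall i, hom p (X i)) (pt : hom p t),
    (forall i, f i ∘ pi i = pt) /\
    forall (q : C) (g : forall i, hom q (X i)) (h : hom q t),
      (forall i, f i ∘ g i = h) ->
      exists! u : hom q p, (forall i, pi i ∘ u = g i) /\ pt ∘ u = h.
Proof.
intros prod pb X t f.
destruct (prod X) as [a [pa A]].
destruct (prod (fun _ => t)) as [b [pb' B]].
destruct (B a (fun i => f i ∘ pa i)) as [fa [Hfa _]].
destruct (B t (fun _ => idm t)) as [dt [Hdt _]].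
destruct (pb _ _ _ fa dt) as [p [p1 [p2 [Hp P]]]].
(* The leg to [t] is kept as data: for empty [I] it is the only leg, and the wide pullback is [t]
   itself. *)
exists p, (fun i => pa i ∘ p1), p2; split.
- intros i; rewrite comp_assoc, <- Hfa, <- comp_assoc, Hp, comp_assoc, Hdt.
  apply comp_id_l.
- intros q g h H; destruct (A q g) as [ga [Hga _]].
  destruct (P q ga h) as [u [[Hu1 Hu2] uniq]].
  { apply (product_hom_ext B); intros i.
    now rewrite !comp_assoc, Hfa, Hdt, <- comp_assoc, Hga, H, comp_id_l. }
  exists u; split.
  + split; [|exact Hu2]; intros i; now rewrite <- comp_assoc, Hu1.
  + intros v [V1 V2]; apply uniq; split; [|exact V2].
    apply (product_hom_ext A); intros i; now rewrite comp_assoc, V1, Hga.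
Qed.

(** A position in an enumerating list determines its element; choice selects a position for each
    element. *)
Lemma Finite_countable (I : Type) : Finite I -> countable I.
Proof.
intros [l Hl].
destruct (functional_choice (fun i n => nth_error l n = Some i)
  (fun i => In_nth_error l i (Hl i))) as [f Hf].
exists f; intros i j E; pose proof (Hf i) as H; rewrite E, Hf in H; congruence.
Qed.

(** The product of the empty family is terminal. *)
Lemma has_terminal_of_finite_products (C : Category) :
  has_finite_products C -> has_terminal C.
Proof.
intros H.
destruct (H Empty_set (ex_intro _ nil (fun a : Empty_set => match a with end))
  (fun a => match a with end)) as [t [pi T]].
exists t; intros x; destruct (T x (fun a => match a with end)) as [u [_ U]].
exists u; split; [exact I|]; intros v _; apply U; intros [].
Qed.

(** * The terminal Moore machine and products of Moore machines *)

Section Products.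
Variables (K : Category) (F R : Functor K K) (adj : Adjunction F R).

(** By adjunction, morphisms from [E] to this object correspond to morphisms from [F^n E] to [O]. *)
Fixpoint iter_obj (n : nat) (O : K) : K :=
  match n with 0 => O | S m => R (iter_obj m O) end.

(* The behaviour of [M]: its component at [n] is the output after [n] steps. *)
Fixpoint behaviour (O : K) (M : moore F O) (n : nat) :
    hom (moore_carrier M) (iter_obj n O) :=
  match n with
  | 0 => moore_s M
  | S m => transpose adj (behaviour M m ∘ moore_d M)
  end.

(** On the product of the [R^n O], the output is the projection at [0] and the transition is a
    shift; the morphism from [M] has the components [behaviour M n]. *)
Lemma Mre_has_terminal (O : K) : has_countable_products K -> has_terminal (Mre F O).
Proof.
intros prod.
destruct (prod nat (ex_intro _ (fun n => n) (fun _ _ e => e))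
  (fun n => iter_obj n O)) as [p [pi P]].
(* The shift: component [n] uses the projection at [S n], matching the recursion of [behaviour]. *)
destruct (P (F p) (fun n => untranspose adj (b := iter_obj n O) (pi (S n))))
  as [d [Hd _]].
exists (Build_moore d (pi 0)); intros M.
destruct (P _ (behaviour M)) as [u [Hu uniq]].
assert (Ed : u ∘ moore_d M = d ∘ fmap F u).
{ apply (product_hom_ext P); intros n.
  rewrite !comp_assoc, Hd, <- untranspose_comp_r, (Hu n).
  refine (eq_trans (eq_sym (transposeK adj _)) _).
  exact (f_equal (untranspose adj (b := iter_obj n O)) (eq_sym (Hu (S n)))). }
exists (Build_moore_hom (N := Build_moore d (pi 0)) Ed (Hu 0)); split; [exact I|].
intros v _; apply moore_hom_ext; simpl; apply uniq.
pose proof (moore_mor_d v) as Vd; pose proof (moore_mor_s v) as Vs; simpl in Vd, Vs.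
(* The components of [v] are forced: the output equation settles [0], the transition equation passes
   from [n] to [S n]. *)
intros n; induction n as [|n IH]; [exact Vs|]; simpl.
rewrite <- IH, <- comp_assoc, Vd, comp_assoc, Hd, <- untranspose_comp_r.
now rewrite untransposeK.
Qed.

(** The wide pullback over the carrier of the terminal machine makes all components share one
    behaviour, hence one output, as a machine structure on the product requires. *)
Lemma Mre_has_products (O : K) (I : Type) :
  has_countable_products K -> has_pullbacks K -> countable I ->
  has_products (Mre F O) I.
Proof.
intros prod pb cI X; destruct (Mre_has_terminal O prod) as [T HT].
(* Terminality lives in [Prop], so the family is picked by description; [Tuniq] makes the choice
   immaterial. *)
assert (f : forall i, moore_hom (X i) T).
{ intros i; destruct (constructive_indefinite_description _ (HT (X i))) as [u _].
  exact u. }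
assert (Tuniq : forall (M : moore F O) (u v : moore_hom M T), u = v).
{ intros M u v; destruct (HT M) as [w [_ W]]; now rewrite <- (W u), (W v). }
destruct (wide_pullback (prod I cI) pb (fun i => moore_mor (f i)))
  as [p [pi [pt [Hp P]]]].
assert (ext : forall q (u v : hom q p), (forall i, pi i ∘ u = pi i ∘ v) ->
  pt ∘ u = pt ∘ v -> u = v).
{ intros q u v H Ht; destruct (P q (fun i => pi i ∘ v) (pt ∘ v)) as [w [_ W]].
  { intros i; now rewrite comp_assoc, Hp. }
  now rewrite <- (W u (conj H Ht)); apply W. }
(* The transitions of the factors and of [T] are compatible because each [f i] is a machine
   morphism. *)
destruct (P (F p) (fun i => moore_d (X i) ∘ fmap F (pi i)) (moore_d T ∘ fmap F pt))
  as [d [[Hd Hdt] _]].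
{ intros i; rewrite comp_assoc, moore_mor_d, <- comp_assoc, <- fmap_comp.
  now rewrite Hp. }
(* The output is read off at [T], so it exists for an empty family as well. *)
pose (M := Build_moore d (moore_s T ∘ pt)).
assert (Hs : forall i, moore_s (X i) ∘ pi i = moore_s M).
{ intros i; simpl; now rewrite <- (Hp i), comp_assoc, moore_mor_s. }
exists M, (fun i => Build_moore_hom (M := M) (Hd i) (Hs i)).
intros N g; destruct (constructive_indefinite_description _ (HT N)) as [t _].
destruct (P _ (fun i => moore_mor (g i)) (moore_mor t)) as [u [[Hu Hut] uniq]].
{ intros i; exact (f_equal (@moore_mor _ _ _ _ _)
    (Tuniq _ (moore_comp (f i) (g i)) t)). }
assert (Ed : u ∘ moore_d N = d ∘ fmap F u).
{ apply ext; intros; rewrite !comp_assoc.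
  - now rewrite Hu, Hd, <- comp_assoc, <- fmap_comp, Hu, moore_mor_d.
  - now rewrite Hut, Hdt, <- comp_assoc, <- fmap_comp, Hut, moore_mor_d. }
assert (Es : (moore_s T ∘ pt) ∘ u = moore_s N).
{ now rewrite <- comp_assoc, Hut, moore_mor_s. }
exists (Build_moore_hom (N := M) Ed Es); split.
- intros i; apply moore_hom_ext; apply Hu.
- intros v V; apply moore_hom_ext; simpl; apply uniq; split.
  + intros i; exact (f_equal (@moore_mor _ _ _ _ _) (V i)).
  (* Since [pt] is a machine morphism, terminality identifies [pt ∘ v] with [t]. *)
  + pose (pT := Build_moore_hom (M := M) (N := T) Hdt eq_refl).
    exact (f_equal (@moore_mor _ _ _ _ _) (Tuniq _ (moore_comp pT v) t)).
Qed.

(** * Mealy machines of output [O] as Moore machines of output [R O] *)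

Definition moore_of_mealy (O : K) (M : mealy F O) : moore F (R O) :=
  Build_moore (mealy_d M) (transpose adj (mealy_s M)).

Definition mealy_of_moore (O : K) (M : moore F (R O)) : mealy F O :=
  Build_mealy (moore_d M) (untranspose adj (moore_s M)).

(** Transposing outputs keeps carriers and transitions, and by naturality a morphism of carriers
    respects the outputs exactly when it respects their transposes; so products transfer. *)
Lemma Mly_has_products (O : K) (I : Type) :
  has_products (Mre F (R O)) I -> has_products (Mly F O) I.
Proof.
intros prod X; destruct (prod (fun i => moore_of_mealy (X i))) as [p [pi P]].
assert (Hs : forall i, mealy_s (X i) ∘ fmap F (moore_mor (pi i)) =
  mealy_s (mealy_of_moore p)).
{ intros i; simpl; rewrite <- (moore_mor_s (pi i)), untranspose_comp_r; simpl.
  now rewrite transposeK. }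
exists (mealy_of_moore p), (fun i =>
  Build_mealy_hom (M := mealy_of_moore p) (moore_mor_d (pi i)) (Hs i)).
intros N g.
assert (Gs : forall i, moore_s (moore_of_mealy (X i)) ∘ mealy_mor (g i) =
  moore_s (moore_of_mealy N)).
{ intros i; simpl; now rewrite <- transpose_comp_r, mealy_mor_s. }
destruct (P (moore_of_mealy N) (fun i =>
  Build_moore_hom (M := moore_of_mealy N) (N := moore_of_mealy (X i))
    (mealy_mor_d (g i)) (Gs i))) as [u [Hu uniq]].
assert (Us : mealy_s (mealy_of_moore p) ∘ fmap F (moore_mor u) = mealy_s N).
{ simpl; rewrite <- untranspose_comp_r.
  exact (eq_trans (f_equal (untranspose adj (b := O)) (moore_mor_s u))
    (transposeK adj _)). }
exists (Build_mealy_hom (M := N) (N := mealy_of_moore p) (moore_mor_d u) Us); split.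
- intros i; apply mealy_hom_ext; exact (f_equal (@moore_mor _ _ _ _ _) (Hu i)).
- intros v V; apply mealy_hom_ext; simpl.
  assert (Vs : moore_s p ∘ mealy_mor v = moore_s (moore_of_mealy N)).
  { simpl; rewrite <- (mealy_mor_s v), transpose_comp_r; simpl.
    now rewrite untransposeK. }
  refine (f_equal (@moore_mor _ _ _ _ _) (uniq
    (Build_moore_hom (M := moore_of_mealy N) (N := p) (mealy_mor_d v) Vs) _)).
  intros i; apply moore_hom_ext; exact (f_equal (@mealy_mor _ _ _ _ _) (V i)).
Qed.

End Products.

Theorem theorem3p6 (K : Category) (F R : Functor K K) (adj : Adjunction F R) (O : K) :
  (forall J : Category, has_colimits K J ->
     (has_colimits (Mre F O) J /\ creates_colimits (Mre_forget F O) J) /\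
     (has_colimits (Mly F O) J /\ creates_colimits (Mly_forget F O) J)) /\
  ((creates_limits (Mre_forget F O) parallel_pair /\
    creates_limits (Mly_forget F O) parallel_pair) /\
   (forall J : Category, connected J ->
      creates_limits (Mre_forget F O) J /\ creates_limits (Mly_forget F O) J) /\
   (has_countable_products K -> has_pullbacks K ->
      (has_finite_products (Mre F O) /\ has_terminal (Mre F O)) /\
      (has_finite_products (Mly F O) /\ has_terminal (Mly F O)))).
Proof.
split; [|split; [|split]].
- intros J HJ.
  pose proof (Mre_creates_colimits (O := O) adj (J := J)) as cMre.
  pose proof (Mly_creates_colimits (O := O) adj (J := J)) as cMly.
  split; (split; [|assumption]); eapply has_colimits_of_creates; eassumption.
- split; [apply Mre_creates_connected_limits|apply Mly_creates_connected_limits];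
    apply parallel_pair_connected.
- intros J cJ; split;
    [now apply Mre_creates_connected_limits|now apply Mly_creates_connected_limits].
- intros prod pb.
  (* The output stays general because the Mealy case uses [O' := R O]. *)
  assert (fin : forall O', has_finite_products (Mre F O')).
  { intros O' I fI.
    now apply (Mre_has_products adj prod pb), Finite_countable. }
  assert (finMly : has_finite_products (Mly F O)).
  { intros I fI; now apply (Mly_has_products adj), fin. }
  auto using has_terminal_of_finite_products.
Qed.
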